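(* Let $0<\alpha\le 1$, $\nu>0$, $\xi_0>0$. For $\xi>0$ let $\varphi(k,\xi)$ and $\psi(k,\xi)$, $k\in\mathbb{N}_0$, be the coefficients of $u^k$ in the power series at $u=0$ of $$\bar\varphi(u)=\frac{\xi^{\nu}}{(\xi+(1-u)^{\alpha})^{\nu}},\qquad \bar\psi(u)=\left(1-(1-u)^{\alpha}\right)\frac{\xi^{\nu}}{(\xi+(1-u)^{\alpha})^{\nu}},$$ respectively. Then for every $t>0$, as $h\to0$ with $t/h\in\mathbb{N}$ (i.e. $h=t/k$, $k\to\infty$), $$\lim_{h\to 0}\frac1h\,\psi\!\left(\frac th,\xi_0h^{\alpha}\right)=\lim_{h\to 0}\frac1h\,\varphi\!\left(\frac th,\xi_0h^{\alpha}\right)=\xi_0^{\nu}t^{\alpha\nu-1}E^{\nu}_{\alpha,\alpha\nu}(-\xi_0t^{\alpha}).$$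
   Context: $\mathbb{N}_0=\{0,1,2,\dots\}$. The Prabhakar (three-parameter Mittag-Leffler) function is $E_{a,b}^c(z)=\sum_{m=0}^{\infty}\frac{(c)_m}{m!}\frac{z^m}{\Gamma(am+b)}$, where $(c)_0=1$ and $(c)_m=c(c+1)\cdots(c+m-1)$. The right-hand side is the waiting-time density of the continuous-time Prabhakar renewal process (generalized fractional Poisson process), whose Laplace transform is $\xi_0^{\nu}/(\xi_0+s^{\alpha})^{\nu}$. *)

(* Defs.v *)
From Stdlib Require Import Reals Factorial.
From Coquelicot Require Import Coquelicot.
Local Open Scope R_scope.

(* Euler's integral.  It converges, and so means the Gamma function, for
   x > 0 only; no other argument occurs in [prabhakar a b c] for a, b > 0. *)
Definition Gamma (x : R) : R :=
  RInt_gen (fun s => Rpower s (x - 1) * exp (- s))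
    (at_right 0) (Rbar_locally p_infty).

Fixpoint pochhammer (c : R) (m : nat) : R :=
  match m with
  | O => 1
  | S p => pochhammer c p * (c + INR p)
  end.

(* The three-parameter Mittag-Leffler function E_{a,b}^c(z). *)
Definition prabhakar (a b c z : R) : R :=
  Series (fun m => pochhammer c m / INR (fact m)
                   * (z ^ m / Gamma (a * INR m + b))).

(* [a k] is the coefficient of u^k in the power series of [f] at u = 0: the
   series converges to [f] near 0.  This determines [a]. *)
Definition power_series_at_0 (f : R -> R) (a : nat -> R) : Prop :=
  locally 0 (fun u : R => is_pseries a u (f u)).

(* [Rpower] is the real power for positive bases only; below, the bases are
   positive for u < 1, hence near u = 0. *)
Definition phi_bar (alpha nu xi u : R) : R :=
  Rpower xi nu / Rpower (xi + Rpower (1 - u) alpha) nu.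

Definition psi_bar (alpha nu xi u : R) : R :=
  (1 - Rpower (1 - u) alpha)
  * (Rpower xi nu / Rpower (xi + Rpower (1 - u) alpha) nu).

(* Main.v *)
Require Import Defs.
From Stdlib Require Import Reals Factorial Lra Lia.
From Coquelicot Require Import Coquelicot.
Local Open Scope R_scope.

(** Write [c_k(b) = (b)_k / k!] for the coefficients of [(1 - u)^(-b)].  For
    small [xi] one expands
    [(xi + w)^(-nu) = sum_m c_m(nu) (-xi)^m w^(-nu - m)] at [w = (1 - u)^alpha],
    so that the coefficient of [u^k] in [phi_bar] is
    [xi^nu sum_m c_m(nu) (-xi)^m c_k(alpha m + alpha nu)].  With
    [xi = lam k^(-alpha)], [lam = xi0 t^alpha], [k] times this coefficient is
    [lam^nu sum_m c_m(nu) (-lam)^m k^(1 - b_m) c_k(b_m)],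
    [b_m = alpha m + alpha nu].  By Gauss's limit
    [k^(1 - b) c_k(b) -> 1 / Gamma b], and the estimate
    [k^(1 - b) |c_k(b)| <= C_q q^(-b)], valid for every [q] and all large [k],
    permits the passage to the limit under the sum.  The difference
    [phi_bar - psi_bar = (1 - u)^alpha phi_bar] has the same expansion with
    [b_m] lowered by [alpha], which leaves a factor [k^(-alpha) -> 0]. *)

(** * Rising binomial coefficients and the binomial series *)

Definition risebin (b : R) (k : nat) : R := pochhammer b k / INR (fact k).

Lemma INR_S_pos (n : nat) : 0 < INR n + 1.
Proof. generalize (pos_INR n); lra. Qed.

Lemma risebin_0 (b : R) : risebin b 0 = 1.
Proof. unfold risebin; simpl; field. Qed.

Lemma risebin_S (b : R) (k : nat) :
  risebin b (S k) = risebin b k * ((b + INR k) / (INR k + 1)).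
Proof.
unfold risebin; rewrite fact_simpl, mult_INR, S_INR; simpl pochhammer.
field; split; [generalize (INR_S_pos k); lra | apply INR_fact_neq_0].
Qed.

Lemma risebin_pos (b : R) (k : nat) : 0 < b -> 0 < risebin b k.
Proof.
intros Hb; induction k as [|k IH]; [rewrite risebin_0; lra|].
rewrite risebin_S; apply Rmult_lt_0_compat; [exact IH|].
apply Rdiv_lt_0_compat; [generalize (pos_INR k); lra | apply INR_S_pos].
Qed.

Lemma risebin_abs_le (b c : R) (k : nat) :
  Rabs b <= c -> Rabs (risebin b k) <= risebin c k.
Proof.
intros Hbc; induction k as [|k IH]; [rewrite !risebin_0, Rabs_R1; lra|].
rewrite !risebin_S, Rabs_mult.
apply Rmult_le_compat; [apply Rabs_pos | apply Rabs_pos | exact IH |].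
unfold Rdiv; rewrite Rabs_mult, (Rabs_pos_eq (/ _)).
2: left; apply Rinv_0_lt_compat, INR_S_pos.
apply Rmult_le_compat_r; [left; apply Rinv_0_lt_compat, INR_S_pos|].
eapply Rle_trans; [apply Rabs_triang|].
rewrite (Rabs_pos_eq (INR k)) by apply pos_INR; lra.
Qed.

(** Both sides are [(b)_(k+1) / k!]. The identity trades the parameter [b] for [b + 1]; this drives
    the induction in Gauss's limit and gives access to parameters in [(-1, 0]]. *)
Lemma risebin_shift (b : R) (k : nat) :
  risebin b k * (b + INR k) = b * risebin (b + 1) k.
Proof.
induction k as [|k IH]; [rewrite !risebin_0; simpl; ring|].
rewrite !risebin_S, S_INR.
replace (b * (risebin (b + 1) k * ((b + 1 + INR k) / (INR k + 1))))
  with (b * risebin (b + 1) k * ((b + 1 + INR k) / (INR k + 1))) by ring.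
rewrite <- IH; field; generalize (INR_S_pos k); lra.
Qed.

(** Division of [(1 - u)^(-b)] by [1 - u] forms the partial sums of its coefficients and yields
    [(1 - u)^(-(b + 1))]. *)
Lemma sum_risebin (b : R) (k : nat) :
  sum_n (risebin b) k = risebin (b + 1) k.
Proof.
induction k as [|k IH]; [now rewrite sum_O, !risebin_0|].
rewrite sum_Sn, IH; unfold plus; simpl.
generalize (risebin_shift b k); intros Hs; rewrite !risebin_S.
replace (risebin b k * ((b + INR k) / (INR k + 1)))
  with (risebin b k * (b + INR k) / (INR k + 1))
  by (field; generalize (INR_S_pos k); lra).
rewrite Hs; field; generalize (INR_S_pos k); lra.
Qed.

Lemma is_lim_seq_shift_ratio (b c : R) :
  is_lim_seq (fun k => (b + INR k) / (INR k + c)) 1.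
Proof.
apply is_lim_seq_ext_loc with (fun k => 1 + (b - c) * / (INR k + c)).
  destruct (nfloor_ex (Rabs c) (Rabs_pos c)) as [N HN].
  exists (S N); intros n Hn; field.
  apply le_INR in Hn; rewrite S_INR in Hn.
  generalize (Rle_abs (- c)); rewrite Rabs_Ropp; lra.
replace (Finite 1) with (Rbar_plus 1 (Rbar_mult (b - c) 0))
  by (simpl; f_equal; ring).
apply is_lim_seq_plus'; [apply is_lim_seq_const|].
apply (is_lim_seq_scal_l _ (b - c) 0).
replace (Finite 0) with (Rbar_inv p_infty) by reflexivity.
apply is_lim_seq_inv; [|easy].
eapply is_lim_seq_plus; [apply is_lim_seq_INR | apply is_lim_seq_const |].
easy.
Qed.

(** The ratio test needs nonzero coefficients, but for [b = 0, -1, -2, ...] they vanish from some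
    index on. It is applied to the parameter [Rabs b + 1] instead, whose coefficients majorize those
    of [b], so that the radius for [b] is at least 1. *)
Lemma risebin_CV_radius (b u : R) :
  Rabs u < 1 -> Rbar_lt (Rabs u) (CV_radius (risebin b)).
Proof.
intros Hu.
assert (Hc : CV_radius (risebin (Rabs b + 1)) = 1).
  assert (Hp : 0 < Rabs b + 1) by (generalize (Rabs_pos b); lra).
  replace (Finite 1) with (Finite (/ 1)) by (f_equal; field).
  apply CV_radius_finite_DAlembert; [| lra |].
    intros n; generalize (risebin_pos _ n Hp); lra.
  apply is_lim_seq_ext with (2 := is_lim_seq_shift_ratio (Rabs b + 1) 1).
  intros n; rewrite risebin_S, (Rabs_pos_eq (_ / _)).
    generalize (risebin_pos _ n Hp) (INR_S_pos n); intros; field; lra.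
  generalize (risebin_pos _ n Hp) (INR_S_pos n) (pos_INR n); intros.
  apply Rdiv_le_0_compat; [|easy].
  left; apply Rmult_lt_0_compat; [easy|apply Rdiv_lt_0_compat; lra].
apply Rbar_lt_le_trans with (Finite 1); [exact Hu|].
rewrite <- Hc.
refine (is_lub_Rbar_subset _ _ _ _ _ (CV_radius_bounded _) (CV_radius_bounded _)).
intros r [M HM]; exists M; intros n; eapply Rle_trans; [|apply (HM n)].
rewrite !Rabs_mult; apply Rmult_le_compat_r; [apply Rabs_pos|].
eapply Rle_trans; [apply (risebin_abs_le b (Rabs b + 1)); lra|].
apply Rle_abs.
Qed.

(* [f u = sum risebin b k u^k] solves [(1 - u) f' = b f], so that
   [f u * (1 - u)^b] is constant. *)
Lemma is_series_risebin (b u : R) :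
  Rabs u < 1 ->
  is_series (fun k => risebin b k * u ^ k) (Rpower (1 - u) (- b)).
Proof.
intros Hu.
set (f := PSeries (risebin b)).
assert (Hode : forall x, Rabs x < 1 ->
          (1 - x) * PSeries (PS_derive (risebin b)) x = b * f x).
  intros x Hx.
  assert (Hr := risebin_CV_radius b x Hx).
  assert (Hd := ex_pseries_derive _ _ Hr).
  assert (He := CV_radius_inside _ _ Hr).
  unfold f; rewrite Rmult_minus_distr_r, Rmult_1_l, <- PSeries_incr_1.
  rewrite <- PSeries_minus; [| exact Hd | apply ex_pseries_incr_1, Hd].
  rewrite <- PSeries_scal; apply PSeries_ext.
  intros [|n]; unfold PS_minus, PS_plus, PS_opp, PS_scal, PS_derive, PS_incr_1,
    plus, opp, scal, zero, mult; simpl.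
    rewrite risebin_S; unfold mult; simpl; field.
  rewrite (risebin_S _ (S n)), S_INR; unfold mult; simpl.
  change (match n with 0%nat => 1 | S _ => INR n + 1 end) with (INR (S n)).
  rewrite S_INR; field.
  generalize (pos_INR n); lra.
assert (Hder : forall x, Rabs x < 1 ->
          is_derive (fun x => f x * Rpower (1 - x) b) x 0).
  intros x Hx.
  assert (Hx1 : 0 < 1 - x) by (generalize (Rle_abs x); lra).
  evar_last.
    apply (is_derive_mult f (fun x => Rpower (1 - x) b)).
    - apply is_derive_PSeries, risebin_CV_radius, Hx.
    - unfold Rpower; auto_derive; [exact Hx1 | reflexivity].
    - intros; apply Rmult_comm.
  unfold plus, mult; simpl.
  fold (Rpower (1 + - x) b); change (1 + - x) with (1 - x).
  replace (PSeries (PS_derive (risebin b)) x) with (b * f x / (1 - x))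
    by (rewrite <- Hode by exact Hx; field; lra).
  field; lra.
assert (Hconst : f u * Rpower (1 - u) b = 1).
  transitivity (f 0 * Rpower (1 - 0) b).
    destruct (MVT_gen (fun x => f x * Rpower (1 - x) b) 0 u (fun _ => 0))
      as [c [_ Hc]].
    - intros x Hx; apply Hder; revert Hu Hx.
      unfold Rmin, Rmax, Rabs; repeat destruct Rle_dec;
        repeat destruct Rcase_abs; lra.
    - intros x Hx; apply continuity_pt_filterlim.
      apply (ex_derive_continuous (fun x => f x * Rpower (1 - x) b)).
      exists 0; apply Hder; revert Hu Hx.
      unfold Rmin, Rmax, Rabs; repeat destruct Rle_dec;
        repeat destruct Rcase_abs; lra.
    - lra.
  unfold f; rewrite PSeries_0, risebin_0, Rminus_0_r.
  unfold Rpower; rewrite ln_1, Rmult_0_r, exp_0; ring.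
replace (Rpower (1 - u) (- b)) with (f u).
  apply is_series_ext with (fun k => scal (pow_n u k) (risebin b k)).
    intros k; rewrite pow_n_pow; apply Rmult_comm.
  apply PSeries_correct, CV_radius_inside, risebin_CV_radius, Hu.
rewrite Rpower_Ropp.
apply (Rmult_eq_reg_r (Rpower (1 - u) b));
  [rewrite Hconst, Rinv_l; [easy|]|]; apply Rgt_not_eq, exp_pos.
Qed.

(** All terms are nonnegative, so the partial sums stay below the value of the binomial series. *)
Lemma sum_n_risebin_le (b r : R) (k : nat) :
  0 <= b -> 0 <= r < 1 ->
  sum_n (fun j => risebin b j * r ^ j) k <= Rpower (1 - r) (- b).
Proof.
intros Hb Hr.
assert (Hs := is_series_risebin b r
  (eq_ind_r (fun x => x < 1) (proj2 Hr) (Rabs_pos_eq r (proj1 Hr)))).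
refine (is_lim_seq_incr_compare (sum_n (fun j => risebin b j * r ^ j))
  (Rpower (1 - r) (- b)) Hs _ k).
intros n; rewrite sum_Sn; unfold plus; simpl.
assert (0 <= risebin b (S n) * (r * r ^ n)); [|lra].
apply Rmult_le_pos; [|apply Rmult_le_pos; [lra|apply pow_le; lra]].
eapply Rle_trans; [apply (Rabs_pos (risebin b (S n)))|].
apply risebin_abs_le; rewrite Rabs_pos_eq; lra.
Qed.

Lemma risebin_nonneg (b : R) (k : nat) : 0 <= b -> 0 <= risebin b k.
Proof.
intros Hb; eapply Rle_trans; [apply (Rabs_pos (risebin b k))|].
apply risebin_abs_le; rewrite Rabs_pos_eq; lra.
Qed.

Lemma Rpower_nonneg (x y : R) : 0 <= Rpower x y.
Proof. left; apply exp_pos. Qed.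

(** * Dominated convergence for series *)

(** Tannery's theorem. The cut-off [K] is read off the tail of [M] alone, hence serves [g] and all
    late [f n] at once; the finite sums up to [K] converge term by term. *)
Lemma is_lim_seq_Series_dominated (f : nat -> nat -> R) (g M : nat -> R) :
  ex_series M ->
  eventually (fun n => forall m, Rabs (f n m) <= M m) ->
  (forall m, is_lim_seq (fun n => f n m) (g m)) ->
  is_lim_seq (fun n => Series (f n)) (Series g).
Proof.
intros HM Hf Hg.
assert (HgM : forall m, Rabs (g m) <= M m).
  intros m.
  apply (is_lim_seq_le_loc (fun n => Rabs (f n m)) (fun _ => M m)
           (Rabs (g m)) (M m)).
  - destruct Hf as [N HN]; exists N; intros n Hn; apply HN, Hn.
  - apply (is_lim_seq_abs _ (g m)), Hg.
  - apply is_lim_seq_const.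
apply is_lim_seq_spec; intros eps; simpl.
assert (Htail : exists K : nat, forall h, (forall m, Rabs (h m) <= M m) ->
          Rabs (Series h - sum_n h K) < eps / 3).
  destruct (HM) as [l Hl].
  assert (HS' := proj1 (filterlim_locally (sum_n M) l) Hl
                   (mkposreal (eps / 3) ltac:(destruct eps; simpl; lra))).
  destruct HS' as [K HK]; exists K; intros h Hh.
  specialize (HK K (le_n K)).
  assert (Hha : ex_series (fun m => Rabs (h m))).
    apply (ex_series_le (fun m => Rabs (h m)) M); [|exact HM].
    intros m; unfold norm; simpl; unfold abs; simpl.
    rewrite Rabs_Rabsolu; apply Hh.
  assert (Hhe : ex_series h) by (apply ex_series_Rabs, Hha).
  assert (HhK : ex_series (fun m => h (S K + m)%nat))
    by (apply (ex_series_incr_n h (S K)), Hhe).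
  rewrite (Series_incr_n h (S K)); [|lia|exact Hhe].
  rewrite sum_n_Reals; simpl pred.
  replace (sum_f_R0 h K + Series (fun k => h (S K + k)%nat) - sum_f_R0 h K)
    with (Series (fun k => h (S K + k)%nat)) by ring.
  eapply Rle_lt_trans; [apply Series_Rabs|].
    apply (ex_series_incr_n (fun m => Rabs (h m)) (S K)), Hha.
  eapply Rle_lt_trans; [apply (Series_le _ (fun k => M (S K + k)%nat))|].
  - intros m; split; [apply Rabs_pos | apply Hh].
  - apply (ex_series_incr_n M (S K)), HM.
  - assert (HSM := Series_incr_n M (S K) ltac:(lia) HM).
    rewrite (is_series_unique _ _ Hl) in HSM; simpl pred in HSM.
    rewrite <- sum_n_Reals in HSM.
    change (Rabs (sum_n M K - l) < eps / 3) in HK.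
    apply Rabs_lt_between in HK; lra.
destruct Htail as [K HK].
assert (Hfin : is_lim_seq (fun n => sum_n (f n) K) (sum_n g K)).
  clear -Hg; induction K as [|K IH].
    apply is_lim_seq_ext with (fun n => f n 0%nat);
      [intros; now rewrite sum_O | rewrite sum_O; apply Hg].
  apply is_lim_seq_ext with (fun n => sum_n (f n) K + f n (S K));
    [intros; now rewrite sum_Sn|].
  rewrite sum_Sn; apply is_lim_seq_plus'; [exact IH | apply Hg].
apply is_lim_seq_spec in Hfin.
specialize (Hfin (mkposreal (eps / 3) ltac:(destruct eps; simpl; lra))).
simpl in Hfin; unfold eventually in *.
destruct Hf as [N1 H1], Hfin as [N2 H2].
exists (max N1 N2); intros n Hn.
assert (A := HK (f n) (H1 n ltac:(lia))).
assert (B := HK g HgM).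
assert (C := H2 n ltac:(lia)).
apply Rabs_lt_between in A, B, C; apply Rabs_lt_between; lra.
Qed.

Lemma exp_le_compat (x y : R) : x <= y -> exp x <= exp y.
Proof.
intros [H | ->]; [left; now apply exp_increasing | apply Rle_refl].
Qed.

(** * Improper integrals over the positive half-line *)

Definition is_RInt_0_infty (f : R -> R) (l : R) : Prop :=
  is_RInt_gen f (at_right 0) (Rbar_locally p_infty) l.

Lemma filter_prod_0_infty (P : R -> R -> Prop) (a0 b0 : R) :
  0 < a0 ->
  (forall a b, 0 < a < a0 -> b0 < b -> P a b) ->
  filter_prod (at_right 0) (Rbar_locally p_infty)
    (fun ab : R * R => P (fst ab) (snd ab)).
Proof.
intros Ha H.
apply (Filter_prod _ _ _ (fun a => 0 < a < a0) (fun b => b0 < b)).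
- exists (mkposreal a0 Ha); intros y Hy Hy0; split; [exact Hy0|].
  unfold ball in Hy; simpl in Hy; unfold AbsRing_ball, abs, minus, plus, opp in Hy;
    simpl in Hy.
  apply Rabs_lt_between in Hy; lra.
- exists b0; auto.
- exact H.
Qed.

Lemma is_RInt_0_infty_ext (f g : R -> R) (l : R) :
  (forall s, 0 < s -> f s = g s) -> is_RInt_0_infty f l -> is_RInt_0_infty g l.
Proof.
intros H Hf.
refine (@is_RInt_gen_ext R_NormedModule (at_right 0) (Rbar_locally p_infty)
  _ _ f g l _ Hf).
apply (filter_prod_0_infty
  (fun a b => forall x, Rmin a b < x < Rmax a b -> f x = g x) 1 1); [lra|].
intros a b Ha Hb x Hx; apply H.
rewrite Rmin_left in Hx by lra; lra.
Qed.

Lemma is_RInt_0_infty_lin (f g : R -> R) (a b lf lg : R) :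
  is_RInt_0_infty f lf -> is_RInt_0_infty g lg ->
  is_RInt_0_infty (fun s => a * f s + b * g s) (a * lf + b * lg).
Proof.
intros Hf Hg.
exact (is_RInt_gen_plus _ _ _ _
  (is_RInt_gen_scal _ a _ Hf) (is_RInt_gen_scal _ b _ Hg)).
Qed.

(** The difference [g - f] is its own majorant in norm, which gives [0 <= |lg - lf| <= lg - lf]. *)
Lemma is_RInt_0_infty_le (f g : R -> R) (lf lg : R) :
  (forall s, 0 < s -> f s <= g s) ->
  is_RInt_0_infty f lf -> is_RInt_0_infty g lg -> lf <= lg.
Proof.
intros H Hf Hg.
assert (Hd := is_RInt_gen_minus _ _ _ _ Hg Hf).
assert (Hn : norm (minus lg lf) <= minus lg lf).
  refine (RInt_gen_norm _ _ _ _ _ _ Hd Hd).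
  - apply (filter_prod_0_infty (fun a b => a <= b) 1 1); [lra | intros; lra].
  - apply (filter_prod_0_infty (fun a b => forall x, a <= x <= b ->
      norm (minus (g x) (f x)) <= minus (g x) (f x)) 1 1); [lra|].
    intros a b Ha Hb x Hx; unfold norm, minus, plus, opp; simpl; unfold abs; simpl.
    assert (Hx0 := H x ltac:(lra)); rewrite Rabs_pos_eq; lra.
assert (Hp := norm_ge_0 (minus lg lf)).
unfold minus, plus, opp in *; simpl in *; lra.
Qed.

Lemma is_RInt_0_infty_unique (f : R -> R) (l1 l2 : R) :
  is_RInt_0_infty f l1 -> is_RInt_0_infty f l2 -> l1 = l2.
Proof.
intros H1 H2; apply Rle_antisym;
  [apply (is_RInt_0_infty_le f f) | apply (is_RInt_0_infty_le f f)];
  try assumption; intros; apply Rle_refl.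
Qed.

(** The limit is the supremum of the integrals over compact subintervals. Since [f >= 0], enlarging
    an interval whose integral is within [eps] of the supremum keeps it within [eps]. *)
Lemma ex_RInt_0_infty_bounded (f : R -> R) (B : R) :
  (forall s, 0 < s -> continuous f s) ->
  (forall s, 0 < s -> 0 <= f s) ->
  (forall a b, 0 < a <= b -> RInt f a b <= B) ->
  exists l, is_RInt_0_infty f l.
Proof.
intros Hc Hpos HB.
assert (Hex : forall a b, 0 < a <= b -> ex_RInt f a b).
  intros a b Hab; apply (ex_RInt_continuous (V := R_CompleteNormedModule)).
  intros z Hz; apply Hc; rewrite Rmin_left in Hz; lra.
assert (H0 : forall a b, 0 < a <= b -> 0 <= RInt f a b).
  intros a b Hab; apply RInt_ge_0; [lra | now apply Hex | intros; apply Hpos; lra].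
destruct (completeness (fun y => exists a b, 0 < a <= b /\ y = RInt f a b))
  as [l [Hub Hlub]].
- exists B; intros y [a [b [Hab ->]]]; now apply HB.
- exists (RInt f 1 1), 1, 1; split; [lra | easy].
- exists l; intros P [eps HP].
  assert (Happ : exists a0 b0, 0 < a0 <= b0 /\ l - eps < RInt f a0 b0).
    destruct (Classical_Prop.classic
      (exists a0 b0, 0 < a0 <= b0 /\ l - eps < RInt f a0 b0)) as [He|Hn]; [easy|].
    exfalso; assert (l <= l - eps); [|destruct eps; simpl in *; lra].
    apply Hlub; intros y [a [b [Hab ->]]].
    apply Rnot_lt_le; intros Hlt; apply Hn; now exists a, b.
  destruct Happ as [a0 [b0 [Hab0 Hl]]].
  apply (filter_prod_0_infty
    (fun a b => exists y, is_RInt f a b y /\ P y) a0 b0); [lra|].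
  intros a b Ha Hb; exists (RInt f a b); split.
    apply (RInt_correct (V := R_CompleteNormedModule)), Hex; lra.
  apply HP.
  assert (Hle : RInt f a b <= l)
    by (apply Hub; exists a, b; split; [lra | easy]).
  assert (Hsplit : RInt f a b = RInt f a a0 + (RInt f a0 b0 + RInt f b0 b)).
    rewrite <- (RInt_Chasles f a a0 b) by (apply Hex; lra).
    rewrite <- (RInt_Chasles f a0 b0 b) by (apply Hex; lra).
    easy.
  assert (Hl1 := H0 a a0 ltac:(lra)); assert (Hl2 := H0 b0 b ltac:(lra)).
  unfold ball; simpl; unfold AbsRing_ball, abs, minus, plus, opp; simpl.
  apply Rabs_lt_between; lra.
Qed.

(** * Convergence and functional equation of the Gamma integral *)

Definition gamma_integrand (x s : R) : R := Rpower s (x - 1) * exp (- s).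

Lemma continuous_gamma_integrand (x s : R) :
  0 < s -> continuous (gamma_integrand x) s.
Proof.
intros Hs; apply (ex_derive_continuous (gamma_integrand x)).
unfold gamma_integrand, Rpower; auto_derive; exact Hs.
Qed.

Lemma ln_le_sub_1 (y : R) : 0 < y -> ln y <= y - 1.
Proof.
intros Hy; generalize (exp_ineq1_le (ln y)); rewrite exp_ln by exact Hy; lra.
Qed.

(** This is [ln y <= y - 1] at [y = s / (2 x)], multiplied by [x]: the scale [2 x] makes the linear
    term exactly [s / 2]. *)
Lemma Rpower_le_exp_half (x s : R) :
  0 < x -> 0 < s -> Rpower s x <= Rpower (2 * x) x * exp (s / 2).
Proof.
intros Hx Hs; unfold Rpower; rewrite <- exp_plus.
apply exp_le_compat.
replace s with ((s / (2 * x)) * (2 * x)) at 1 by (field; lra).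
assert (Hd : 0 < s / (2 * x)) by (apply Rdiv_lt_0_compat; lra).
rewrite ln_mult by lra.
assert (Hl := ln_le_sub_1 _ Hd).
apply (Rmult_le_compat_l x) in Hl; [|lra].
replace (x * (s / (2 * x) - 1)) with (s / 2 - x) in Hl by (field; lra).
lra.
Qed.

(* The integrand is dominated by a multiple of the derivative of
   [-1 / (1 + s^x)], which is bounded on the whole half-line. *)
Lemma ex_Gamma_integral (x : R) :
  0 < x -> exists l, is_RInt_0_infty (gamma_integrand x) l.
Proof.
intros Hx.
set (C := Rpower (2 * x) x).
assert (HC : 0 < C) by apply exp_pos.
(* From [s^x <= C exp(s/2)] follows [exp(-s/2) (1 + s^x) <= 1 + C], and squaring gives
   [exp(-s) <= (1 + C)^2 / (1 + s^x)^2]. The factor [1 / x] comes from the antiderivative of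
   [s^(x-1) / (1 + s^x)^2]. *)
apply (ex_RInt_0_infty_bounded _ ((1 + C) ^ 2 / x)).
- intros s; apply continuous_gamma_integrand.
- intros s Hs; apply Rmult_le_pos; left; apply exp_pos.
- intros a b Hab.
  set (F := fun s => - ((1 + C) ^ 2 / x / (1 + Rpower s x))).
  set (F' := fun s => (1 + C) ^ 2 * (Rpower s (x - 1) / (1 + Rpower s x) ^ 2)).
  assert (HF : is_RInt F' a b (F b - F a)).
    apply (is_RInt_derive F F').
    + intros s Hs; rewrite Rmin_left, Rmax_right in Hs by lra.
      unfold F, F'.
      replace (Rpower s (x - 1)) with (Rpower s x / s).
        unfold Rpower; auto_derive.
          split; [lra|split; [|easy]].
          generalize (exp_pos (x * ln s)); lra.
        field; repeat split; try lra.
        generalize (exp_pos (x * ln s)); lra.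
      unfold Rminus; rewrite Rpower_plus, Rpower_Ropp, Rpower_1 by lra; easy.
    + intros s Hs; rewrite Rmin_left, Rmax_right in Hs by lra.
      apply (ex_derive_continuous F').
      unfold F', Rpower; auto_derive; repeat split; try lra.
      generalize (exp_pos (x * ln s)); intros; nra.
  apply Rle_trans with (F b - F a).
  + rewrite <- (is_RInt_unique _ _ _ _ HF).
    apply RInt_le; [lra | | now exists (F b - F a) |].
      apply (ex_RInt_continuous (V := R_CompleteNormedModule)).
      intros z Hz; rewrite Rmin_left in Hz by lra.
      apply continuous_gamma_integrand; lra.
    intros s Hs; unfold gamma_integrand, F'.
    replace ((1 + C) ^ 2 * (Rpower s (x - 1) / (1 + Rpower s x) ^ 2))
      with (Rpower s (x - 1) * ((1 + C) ^ 2 / (1 + Rpower s x) ^ 2))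
      by (field; generalize (exp_pos (x * ln s)); unfold Rpower; lra).
    apply Rmult_le_compat_l; [apply Rpower_nonneg|].
    assert (Hp := Rpower_nonneg s x).
    apply (Rmult_le_reg_r ((1 + Rpower s x) ^ 2)); [nra|].
    replace ((1 + C) ^ 2 / (1 + Rpower s x) ^ 2 * (1 + Rpower s x) ^ 2)
      with ((1 + C) ^ 2) by (field; lra).
    replace (exp (- s)) with (exp (- (s / 2)) ^ 2)
      by (simpl; rewrite Rmult_1_r, <- exp_plus; f_equal; field).
    rewrite <- Rpow_mult_distr; apply pow_incr; split.
      apply Rmult_le_pos; [left; apply exp_pos | lra].
    assert (Hb := Rpower_le_exp_half x s Hx ltac:(lra)); fold C in Hb.
    apply (Rmult_le_reg_l (exp (s / 2))); [apply exp_pos|].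
    rewrite <- Rmult_assoc, <- exp_plus, Rplus_opp_r, exp_0.
    assert (1 <= exp (s / 2)); [|nra].
    rewrite <- exp_0; apply exp_le_compat; lra.
  + unfold F.
    set (D := (1 + C) ^ 2 / x).
    assert (HD : 0 < D) by (apply Rdiv_lt_0_compat; nra).
    assert (Ha := exp_pos (x * ln a)); assert (Hb := exp_pos (x * ln b)).
    fold (Rpower a x) in Ha; fold (Rpower b x) in Hb.
    assert (0 < D / (1 + Rpower b x)) by (apply Rdiv_lt_0_compat; lra).
    assert (D / (1 + Rpower a x) <= D); [|lra].
    apply (Rmult_le_reg_r (1 + Rpower a x)); [lra|].
    unfold Rdiv; rewrite Rmult_assoc, Rinv_l by lra; nra.
Qed.

Lemma is_RInt_Gamma (x : R) :
  0 < x -> is_RInt_0_infty (gamma_integrand x) (Gamma x).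
Proof.
intros Hx; destruct (ex_Gamma_integral x Hx) as [l Hl].
exact (@RInt_gen_correct R_CompleteNormedModule (at_right 0) (Rbar_locally p_infty)
  _ _ (gamma_integrand x) (ex_intro _ l Hl)).
Qed.

Lemma is_RInt_0_infty_derive (f f' : R -> R) (la lb : R) :
  (forall s, 0 < s -> is_derive f s (f' s)) ->
  (forall s, 0 < s -> continuous f' s) ->
  filterlim f (at_right 0) (locally la) ->
  filterlim f (Rbar_locally p_infty) (locally lb) ->
  is_RInt_0_infty f' (lb - la).
Proof.
intros Hd Hc Ha Hb.
apply is_RInt_0_infty_ext with (Derive f).
  intros s Hs; now apply is_derive_unique, Hd.
refine (@is_RInt_gen_Derive (at_right 0) (Rbar_locally p_infty) _ _ f la lb _ _ Ha Hb).
- apply (filter_prod_0_infty (fun a b => forall x,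
    Rmin a b <= x <= Rmax a b -> ex_derive f x) 1 1); [lra|].
  intros a b Hab Hb1 x Hx; rewrite Rmin_left in Hx by lra.
  exists (f' x); apply Hd; lra.
- apply (filter_prod_0_infty (fun a b => forall x,
    Rmin a b <= x <= Rmax a b -> continuous (Derive f) x) 1 1); [lra|].
  intros a b Hab Hb1 x Hx; rewrite Rmin_left in Hx by lra.
  apply (continuous_ext_loc _ f'); [|apply Hc; lra].
  exists (mkposreal x ltac:(lra)); intros y Hy.
  symmetry; apply is_derive_unique, Hd.
  unfold ball in Hy; simpl in Hy; unfold AbsRing_ball, abs, minus, plus, opp in Hy;
    simpl in Hy.
  apply Rabs_lt_between in Hy; lra.
Qed.

Lemma filterlim_exp_neg_scal (c : R) :
  0 < c -> filterlim (fun s => exp (- (c * s))) (Rbar_locally p_infty) (locally 0).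
Proof.
intros Hc.
apply (filterlim_comp _ _ _ (fun s => - (c * s)) exp _ (Rbar_locally m_infty));
  [|apply is_lim_exp_m].
intros P [M HM]; exists (- M / c); intros s Hs; apply HM.
apply (Rmult_lt_compat_l c) in Hs; [|easy].
replace (c * (- M / c)) with (- M) in Hs by (field; lra); lra.
Qed.

Lemma Gamma_1 : Gamma 1 = 1.
Proof.
apply is_RInt_0_infty_unique with (1 := is_RInt_Gamma 1 Rlt_0_1).
replace 1 with (0 - -1) at 2 by ring.
apply is_RInt_0_infty_ext with (fun s => exp (- s)).
  intros s Hs; unfold gamma_integrand.
  replace (1 - 1) with 0 by ring; rewrite Rpower_O by easy; ring.
apply is_RInt_0_infty_derive with (fun s => - exp (- s)).
- intros s Hs; auto_derive; [easy | ring].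
- intros s Hs; apply (ex_derive_continuous (fun s => exp (- s))).
  auto_derive; easy.
- replace (-1) with (- exp (- 0)) by (rewrite Ropp_0, exp_0; ring).
  assert (H0 : continuous (fun s => - exp (- s)) 0).
    apply (ex_derive_continuous (fun s => - exp (- s))); auto_derive; easy.
  intros P HP; apply filter_le_within; exact (H0 P HP).
- replace 0 with (opp 0) by (unfold opp; simpl; ring).
  apply (filterlim_comp _ _ _ (fun s => exp (- s)) opp _ (locally 0));
    [|apply (filterlim_opp (V := R_NormedModule))].
  apply filterlim_ext with (fun s => exp (- (1 * s)));
    [intros; now rewrite Rmult_1_l|].
  apply filterlim_exp_neg_scal; lra.
Qed.

(** Integration by parts: the derivative of [s^x exp(-s)] is [x] times the integrand of [Gamma x]
    minus that of [Gamma (x + 1)], and both boundary values are 0. *)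
Lemma Gamma_plus_1 (x : R) : 0 < x -> Gamma (x + 1) = x * Gamma x.
Proof.
intros Hx.
assert (Hd : is_RInt_0_infty
  (fun s => minus (scal x (gamma_integrand x s)) (gamma_integrand (x + 1) s)) (0 - 0)).
  apply is_RInt_0_infty_derive with (fun s => Rpower s x * exp (- s)).
  - intros s Hs; unfold gamma_integrand, minus, plus, opp, scal; simpl;
      unfold mult; simpl.
    replace (x + 1 - 1) with x by ring.
    replace (Rpower s (x - 1)) with (Rpower s x / s).
      unfold Rpower; auto_derive; [easy | field; lra].
    unfold Rminus; rewrite Rpower_plus, Rpower_Ropp, Rpower_1 by lra; easy.
  - intros s Hs; apply (continuous_minus (V := R_NormedModule)).
      apply (continuous_scal_r x (gamma_integrand x)).
      now apply continuous_gamma_integrand.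
    now apply continuous_gamma_integrand.
  - apply filterlim_locally; intros eps.
    (* For [0 < s < eps^(1/x)] one has [s^x < eps], while [exp(-s) <= 1]. *)
    exists (mkposreal (Rpower eps (/ x)) (exp_pos _)); intros s Hs Hs0.
    unfold ball in Hs |- *; simpl in Hs |- *.
    unfold AbsRing_ball, abs, minus, plus, opp in *; simpl in *.
    rewrite Ropp_0, Rplus_0_r in *; rewrite Rabs_pos_eq in Hs by lra.
    rewrite Rabs_pos_eq by (apply Rmult_le_pos; left; apply exp_pos).
    apply Rlt_le_trans with (eps * 1); [|lra].
    assert (Hlt : Rpower s x < eps).
      replace (pos eps) with (Rpower (Rpower eps (/ x)) x).
        apply Rlt_Rpower_l; lra.
      rewrite Rpower_mult, Rinv_l, Rpower_1; [easy | apply eps | lra].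
    assert (He : exp (- s) <= 1)
      by (rewrite <- exp_0; apply exp_le_compat; lra).
    assert (Hp := exp_pos (- s)); assert (Hq := Rpower_nonneg s x); nra.
  - set (C := Rpower (2 * x) x).
    apply (filterlim_le_le (fun _ => 0) _ (fun s => C * exp (- (/ 2 * s))) 0).
    + exists 0; intros s Hs; split.
        apply Rmult_le_pos; left; apply exp_pos.
      replace (- (/ 2 * s)) with (s / 2 + - s) by field.
      rewrite exp_plus, <- Rmult_assoc.
      apply Rmult_le_compat_r; [left; apply exp_pos|].
      now apply Rpower_le_exp_half.
    + apply filterlim_const.
    + replace (Rbar_locally 0) with (locally (scal C 0))
        by (unfold scal; simpl; unfold mult; simpl; now rewrite Rmult_0_r).
      apply (filterlim_comp _ _ _ (fun s => exp (- (/ 2 * s))) (scal C) _ (locally 0));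
        [|apply (filterlim_scal_r (V := R_NormedModule))].
      apply filterlim_exp_neg_scal; lra.
assert (Hm := is_RInt_gen_minus _ _ _ _
  (is_RInt_gen_scal _ x _ (is_RInt_Gamma x Hx)) (is_RInt_Gamma (x + 1) ltac:(lra))).
apply (is_RInt_0_infty_unique _ _ _ Hd) in Hm.
unfold minus, plus, opp, scal in Hm; simpl in Hm; unfold mult in Hm; simpl in Hm; lra.
Qed.

(** * Tangent inequalities and two-sided bounds for Gamma *)

(** Convexity at 1: [exp y >= 1 + y] at [y = p ln x], then [ln x <= x - 1], reversed by the sign of
    [p]. *)
Lemma Rpower_nonpos_ge_tangent (x p : R) :
  0 < x -> p <= 0 -> 1 + p * (x - 1) <= Rpower x p.
Proof.
intros Hx Hp; unfold Rpower.
apply Rle_trans with (1 + p * ln x); [|apply exp_ineq1_le].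
assert (Hl := ln_le_sub_1 x Hx); nra.
Qed.

(** The weighted inequality of arithmetic and geometric means. With [A = (1 - p) + p x], the bound
    [ln y <= y - 1] is taken at [1 / A] and [x / A] with weights [1 - p] and [p]; the right sides
    then sum to 0. *)
Lemma Rpower_le_tangent (x p : R) :
  0 < x -> 0 <= p <= 1 -> Rpower x p <= 1 + p * (x - 1).
Proof.
intros Hx Hp.
assert (HA : 0 < 1 + p * (x - 1)) by nra.
set (A := 1 + p * (x - 1)) in *.
assert (H : p * ln x <= ln A).
  assert (H1 := ln_le_sub_1 (/ A) ltac:(now apply Rinv_0_lt_compat)).
  assert (H2 := ln_le_sub_1 (x / A) ltac:(now apply Rdiv_lt_0_compat)).
  unfold Rdiv in H2; rewrite ln_mult in H2;
    [|easy | now apply Rinv_0_lt_compat].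
  rewrite ln_Rinv in H1, H2 by easy.
  assert (H3 : (1 - p) * (/ A - 1) + p * (x * / A - 1) = 0)
    by (unfold A; field; unfold A in HA; lra).
  nra.
unfold Rpower; rewrite <- (exp_ln A) by easy; now apply exp_le_compat.
Qed.

(** Normalizes [s] by [y] so that the tangent inequalities at 1 apply to [s / y]; below, [y] is the
    mean of [s] under the weight [gamma_integrand y]. *)
Lemma gamma_integrand_plus (x p y s : R) :
  0 < s -> 0 < y ->
  gamma_integrand (x + p) s
  = Rpower y p * (Rpower (s / y) p * gamma_integrand x s).
Proof.
intros Hs Hy; unfold gamma_integrand.
replace (x + p - 1) with (p + (x - 1)) by ring.
rewrite Rpower_plus, <- !Rmult_assoc, Rpower_mult_distr;
  [| easy | now apply Rdiv_lt_0_compat].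
now replace (y * (s / y)) with s by (field; lra).
Qed.

Lemma gamma_integrand_plus_1 (x s : R) :
  0 < s -> gamma_integrand (x + 1) s = s * gamma_integrand x s.
Proof.
intros Hs; rewrite (gamma_integrand_plus x 1 1 s) by lra.
rewrite !Rpower_1; [field | | lra]; lra.
Qed.

(** Under the weight [gamma_integrand y] the variable [s / y] has mean 1, so the tangent bound
    [1 + p (s/y - 1)] of [(s/y)^p] integrates to [Gamma y]. *)
Lemma Gamma_plus_le (y p : R) :
  0 < y -> 0 <= p <= 1 -> Gamma (y + p) <= Rpower y p * Gamma y.
Proof.
intros Hy Hp.
assert (Hy1 : 0 < y + 1) by lra.
assert (Hyp : 0 < y + p) by lra.
assert (HI := is_RInt_0_infty_lin _ _ (Rpower y p * (1 - p)) (Rpower y p * (p / y))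
  _ _ (is_RInt_Gamma y Hy) (is_RInt_Gamma (y + 1) Hy1)).
rewrite (Gamma_plus_1 y Hy) in HI.
replace (Rpower y p * Gamma y)
  with (Rpower y p * (1 - p) * Gamma y + Rpower y p * (p / y) * (y * Gamma y))
  by (field; lra).
refine (is_RInt_0_infty_le _ _ _ _ _ (is_RInt_Gamma (y + p) Hyp) HI).
intros s Hs.
rewrite (gamma_integrand_plus y p y s), gamma_integrand_plus_1 by easy.
replace (Rpower y p * (1 - p) * gamma_integrand y s
         + Rpower y p * (p / y) * (s * gamma_integrand y s))
  with (Rpower y p * ((1 + p * (s / y - 1)) * gamma_integrand y s)) by (field; lra).
apply Rmult_le_compat_l; [apply Rpower_nonneg|].
apply Rmult_le_compat_r; [apply Rmult_le_pos; left; apply exp_pos|].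
apply Rpower_le_tangent; [now apply Rdiv_lt_0_compat | easy].
Qed.

(** As [z^p] is concave, its tangent bounds it from above only. Writing [z^p = z z^(p-1)] exposes a
    convex factor, whose tangent gives [z (1 + (p - 1)(z - 1))] as lower bound. At [z = s / y] this
    involves the first two moments, that is [Gamma (y + 1)] and [Gamma (y + 2)]. *)
Lemma Gamma_plus_ge (y p : R) :
  0 < y -> 0 <= p <= 1 ->
  Rpower y p * Gamma y * (1 - (1 - p) / y) <= Gamma (y + p).
Proof.
intros Hy Hp.
assert (Hy1 : 0 < y + 1) by lra.
assert (Hy2 : 0 < y + 1 + 1) by lra.
assert (Hyp : 0 < y + p) by lra.
assert (HI := is_RInt_0_infty_lin _ _
  (Rpower y p * ((2 - p) / y)) (Rpower y p * ((p - 1) / y ^ 2))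
  _ _ (is_RInt_Gamma (y + 1) Hy1) (is_RInt_Gamma (y + 1 + 1) Hy2)).
rewrite (Gamma_plus_1 (y + 1) Hy1), (Gamma_plus_1 y Hy) in HI.
replace (Rpower y p * Gamma y * (1 - (1 - p) / y))
  with (Rpower y p * ((2 - p) / y) * (y * Gamma y)
        + Rpower y p * ((p - 1) / y ^ 2) * ((y + 1) * (y * Gamma y)))
  by (field; lra).
refine (is_RInt_0_infty_le _ _ _ _ _ HI (is_RInt_Gamma (y + p) Hyp)).
intros s Hs.
rewrite (gamma_integrand_plus y p y s) by easy.
rewrite !gamma_integrand_plus_1 by easy.
assert (Hsy : 0 < s / y) by now apply Rdiv_lt_0_compat.
replace (Rpower y p * ((2 - p) / y) * (s * gamma_integrand y s)
         + Rpower y p * ((p - 1) / y ^ 2) * (s * (s * gamma_integrand y s)))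
  with (Rpower y p * (s / y * (1 + (p - 1) * (s / y - 1)) * gamma_integrand y s))
  by (field; lra).
apply Rmult_le_compat_l; [apply Rpower_nonneg|].
apply Rmult_le_compat_r; [apply Rmult_le_pos; left; apply exp_pos|].
replace (Rpower (s / y) p) with (s / y * Rpower (s / y) (p - 1)).
  apply Rmult_le_compat_l; [lra|].
  apply Rpower_nonpos_ge_tangent; lra.
rewrite <- (Rpower_1 (s / y)) at 1 by easy.
rewrite <- Rpower_plus; f_equal; ring.
Qed.

(** * Gauss's limit *)

Lemma pochhammer_Gamma (x : R) (k : nat) :
  0 < x -> pochhammer x k * Gamma x = Gamma (x + INR k).
Proof.
intros Hx; induction k as [|k IH]; [simpl; rewrite Rplus_0_r; ring|].
rewrite S_INR, <- Rplus_assoc, Gamma_plus_1 by (generalize (pos_INR k); lra).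
rewrite <- IH; simpl; ring.
Qed.

Lemma pochhammer_1 (k : nat) : pochhammer 1 k = INR (fact k).
Proof.
induction k as [|k IH]; [easy|].
rewrite fact_simpl, mult_INR, S_INR; simpl; rewrite IH; ring.
Qed.

Lemma eventually_INR_pos : eventually (fun k => 1 <= INR k).
Proof. exists 1%nat; intros k Hk; now apply (le_INR 1). Qed.

(** By [(p)_k = Gamma (k + p) / Gamma p] and [k! = k Gamma k], the sequence is [1 / Gamma p] times
    [Gamma (k + p) / (k^p Gamma k)]. The two bounds squeeze the latter between [1 - (1 - p) / k] and
    1. *)
Lemma is_lim_seq_risebin_Gamma_unit (p : R) :
  0 < p <= 1 ->
  is_lim_seq (fun k => Rpower (INR k) (1 - p) * risebin p k) (/ Gamma p).
Proof.
intros Hp.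
assert (HG : 0 < Gamma p).
  (* At [y = 1] the lower bound reads [p <= p Gamma p]. *)
  assert (H := Gamma_plus_ge 1 p ltac:(lra) ltac:(lra)).
  rewrite Gamma_1, (Rplus_comm 1), Gamma_plus_1 in H by lra.
  unfold Rpower in H; rewrite ln_1, Rmult_0_r, exp_0 in H; nra.
assert (Hi : 0 < / Gamma p) by now apply Rinv_0_lt_compat.
apply is_lim_seq_le_le_loc with
  (fun k => / Gamma p * (1 - (1 - p) * / INR k)) (fun _ => / Gamma p).
- apply filter_imp with (2 := eventually_INR_pos); intros k Hk.
  assert (Hfact : INR k * Gamma (INR k) = INR (fact k)).
    rewrite <- Gamma_plus_1, Rplus_comm, <- pochhammer_Gamma, Gamma_1, pochhammer_1
      by lra; ring.
  assert (HGk : 0 < Gamma (INR k)).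
    generalize (INR_fact_lt_0 k); rewrite <- Hfact; intros; nra.
  assert (Hpw : 0 < Rpower (INR k) p) by apply exp_pos.
  replace (Rpower (INR k) (1 - p) * risebin p k)
    with (/ Gamma p * (Gamma (INR k + p) / (Rpower (INR k) p * Gamma (INR k)))).
    assert (Hle := Gamma_plus_le (INR k) p ltac:(lra) ltac:(lra)).
    assert (Hge := Gamma_plus_ge (INR k) p ltac:(lra) ltac:(lra)).
    set (D := Rpower (INR k) p * Gamma (INR k)) in *.
    assert (HD : 0 < D) by now apply Rmult_lt_0_compat.
    split.
      apply Rmult_le_compat_l; [lra|].
      apply (Rmult_le_reg_l D); [easy|].
      replace (D * (Gamma (INR k + p) / D)) with (Gamma (INR k + p)) by (field; lra).
      exact Hge.
    rewrite <- (Rmult_1_r (/ Gamma p)) at 2.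
    apply Rmult_le_compat_l; [lra|].
    apply (Rmult_le_reg_l D); [easy|].
    replace (D * (Gamma (INR k + p) / D)) with (Gamma (INR k + p)) by (field; lra).
    lra.
  unfold risebin, Rminus; rewrite Rpower_plus, Rpower_Ropp, Rpower_1 by lra.
  rewrite <- Hfact, (Rplus_comm (INR k)), <- pochhammer_Gamma by lra.
  field; lra.
- replace (Finite (/ Gamma p)) with (Rbar_mult (/ Gamma p) (Finite (1 - (1 - p) * 0)))
    by (simpl; f_equal; ring).
  apply is_lim_seq_scal_l, is_lim_seq_minus'; [apply is_lim_seq_const|].
  apply (is_lim_seq_scal_l _ (1 - p) 0).
  replace (Finite 0) with (Rbar_inv p_infty) by reflexivity.
  apply is_lim_seq_inv; [apply is_lim_seq_INR | easy].
- apply is_lim_seq_const.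
Qed.

(** Induction on the integer part of [x]: for [x > 1], [risebin_shift] expresses the sequence
    through the one for [x - 1], times [(x - 1 + k) / k -> 1] and divided by [x - 1]. *)
Lemma is_lim_seq_risebin_Gamma (x : R) :
  0 < x ->
  is_lim_seq (fun k => Rpower (INR k) (1 - x) * risebin x k) (/ Gamma x).
Proof.
intros Hx.
destruct (nfloor_ex x ltac:(lra)) as [n [_ Hn]].
revert x Hx Hn; induction n as [|n IH]; intros x Hx Hn.
  apply is_lim_seq_risebin_Gamma_unit; simpl in Hn; lra.
destruct (Rle_lt_dec x 1) as [Hx1|Hx1].
  apply is_lim_seq_risebin_Gamma_unit; lra.
rewrite S_INR in Hn.
assert (H := IH (x - 1) ltac:(lra) ltac:(lra)).
assert (Hr := is_lim_seq_shift_ratio (x - 1) 0).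
apply is_lim_seq_ext_loc with (fun k => / (x - 1) *
  (Rpower (INR k) (1 - (x - 1)) * risebin (x - 1) k * ((x - 1 + INR k) / (INR k + 0)))).
  apply filter_imp with (2 := eventually_INR_pos); intros k Hk.
  assert (Hs := risebin_shift (x - 1) k).
  replace (x - 1 + 1) with x in Hs by ring.
  replace (1 - (x - 1)) with (1 + (1 - x)) by ring.
  rewrite Rpower_plus, Rpower_1 by lra.
  apply (Rmult_eq_reg_l (x - 1)); [|lra].
  transitivity (Rpower (INR k) (1 - x) * (risebin (x - 1) k * (x - 1 + INR k)));
    [field; lra | rewrite Hs; ring].
replace (Finite (/ Gamma x))
  with (Rbar_mult (/ (x - 1)) (Finite (/ Gamma (x - 1) * 1))).
  apply is_lim_seq_scal_l, is_lim_seq_mult'; assumption.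
simpl; f_equal; replace (Gamma x) with (Gamma (x - 1 + 1)) by (f_equal; ring).
rewrite Gamma_plus_1, Rinv_mult by lra; ring.
Qed.

(* [b / Gamma (b + 1)] continues [1 / Gamma b] to [b > -1]. *)
Lemma is_lim_seq_risebin_recip_Gamma (b : R) :
  -1 < b ->
  is_lim_seq (fun k => Rpower (INR k) (1 - b) * risebin b k) (b / Gamma (b + 1)).
Proof.
intros Hb.
assert (H := is_lim_seq_risebin_Gamma (b + 1) ltac:(lra)).
assert (Hr := is_lim_seq_shift_ratio 0 b).
apply is_lim_seq_ext_loc with (fun k => b *
  (Rpower (INR k) (1 - (b + 1)) * risebin (b + 1) k * ((0 + INR k) / (INR k + b)))).
  apply filter_imp with (2 := eventually_INR_pos); intros k Hk.
  assert (Hs := risebin_shift b k).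
  replace (1 - b) with (1 + (1 - (b + 1))) by ring.
  rewrite (Rpower_plus 1), Rpower_1 by lra.
  apply (Rmult_eq_reg_r (INR k + b)); [|lra].
  transitivity (INR k * Rpower (INR k) (1 - (b + 1)) * (b * risebin (b + 1) k));
    [field; lra | rewrite <- Hs; ring].
replace (Finite (b / Gamma (b + 1)))
  with (Rbar_mult b (Finite (/ Gamma (b + 1) * 1)))
  by (simpl; f_equal; unfold Rdiv; ring).
apply is_lim_seq_scal_l, is_lim_seq_mult'; assumption.
Qed.

(** * Bounds on the coefficients, uniform in the exponent *)

(** The left side is the sum of [c_j(g) r^k] over [j <= k], and [r^k <= r^j]. The exponent on the
    right is [g], one better than the binomial series of parameter [g + 1] would give. *)
Lemma sum_risebin_mul_pow_le (g r : R) (k : nat) :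
  0 <= g -> 0 <= r < 1 ->
  risebin (g + 1) k * r ^ k <= Rpower (1 - r) (- g).
Proof.
intros Hg Hr; rewrite <- sum_risebin.
eapply Rle_trans; [|apply (sum_n_risebin_le g r k Hg Hr)].
rewrite !sum_n_Reals, Rmult_comm, scal_sum; apply sum_Rle; intros j Hj.
apply Rmult_le_compat_l; [now apply risebin_nonneg|].
replace k with (j + (k - j))%nat by lia; rewrite pow_add.
rewrite <- (Rmult_1_r (r ^ j)) at 2.
apply Rmult_le_compat_l; [apply pow_le; lra|].
rewrite <- (pow1 (k - j)); apply pow_incr; lra.
Qed.

Lemma risebin_mul_pow_le (g r : R) (k : nat) :
  0 <= g -> 0 <= r < 1 ->
  risebin g k * r ^ k <= Rpower (1 - r) (- g).
Proof.
intros Hg Hr; eapply Rle_trans; [|now apply (sum_risebin_mul_pow_le g r k)].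
apply Rmult_le_compat_r; [apply pow_le; lra|].
eapply Rle_trans; [apply Rle_abs | apply risebin_abs_le].
rewrite Rabs_pos_eq; lra.
Qed.

(** With [x = r / k <= 1/2], [exp(2 x) (1 - x) >= (1 + 2 x)(1 - x) >= 1]; the claim is its [k]-th
    power. *)
Lemma exp_mul_pow_ge_1 (r : R) (k : nat) :
  0 < r -> 2 * r <= INR k -> 1 <= exp (2 * r) * (1 - r / INR k) ^ k.
Proof.
intros Hr Hk.
set (x := r / INR k).
assert (Hx : 0 <= x <= 1 / 2).
  split; [unfold x; left; apply Rdiv_lt_0_compat; lra|].
  unfold x; apply (Rmult_le_reg_r (INR k)); [lra|].
  unfold Rdiv; rewrite Rmult_assoc, Rinv_l; lra.
replace (exp (2 * r)) with (exp (2 * x) ^ k).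
  rewrite <- Rpow_mult_distr, <- (pow1 k) at 1; apply pow_incr; split; [lra|].
  apply Rle_trans with ((1 + 2 * x) * (1 - x)); [nra|].
  apply Rmult_le_compat_r; [lra | apply exp_ineq1_le].
rewrite <- Rpower_pow by apply exp_pos.
unfold Rpower; rewrite ln_exp; f_equal; unfold x; field; lra.
Qed.

(* Averaging [k c_k(g) <= g c_k(g + 1) = g sum_(j <= k) c_j(g)] saves a factor
   [k] over the Cauchy estimate of the single coefficient [c_k(g)]; the radius
   is [1 - r / k]. *)
Lemma INR_mul_risebin_le (g r : R) (k : nat) :
  0 < g -> 0 < r -> 2 * r <= INR k ->
  INR k * risebin g k <= g * (exp (2 * r) * Rpower (INR k / r) g).
Proof.
intros Hg Hr Hk.
apply Rle_trans with (g * risebin (g + 1) k).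
  rewrite <- risebin_shift.
  generalize (risebin_pos g k Hg); intros; nra.
apply Rmult_le_compat_l; [lra|].
assert (Hx : 0 < r / INR k) by (apply Rdiv_lt_0_compat; lra).
assert (Hx2 : r / INR k <= 1 / 2).
  apply (Rmult_le_reg_r (INR k)); [lra|].
  unfold Rdiv; rewrite Rmult_assoc, Rinv_l; lra.
assert (H1 := exp_mul_pow_ge_1 r k Hr Hk).
assert (H2 := sum_risebin_mul_pow_le g (1 - r / INR k) k ltac:(lra) ltac:(lra)).
replace (Rpower (1 - (1 - r / INR k)) (- g)) with (Rpower (INR k / r) g) in H2.
  apply Rle_trans with
    (risebin (g + 1) k * (exp (2 * r) * (1 - r / INR k) ^ k)).
    rewrite <- (Rmult_1_r (risebin _ _)) at 1.
    apply Rmult_le_compat_l; [apply risebin_nonneg; lra | exact H1].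
  replace (risebin (g + 1) k * (exp (2 * r) * (1 - r / INR k) ^ k))
    with (exp (2 * r) * (risebin (g + 1) k * (1 - r / INR k) ^ k)) by ring.
  apply Rmult_le_compat_l; [left; apply exp_pos | exact H2].
replace (1 - (1 - r / INR k)) with (/ (INR k / r)) by (field; lra).
unfold Rpower; rewrite ln_Rinv; [f_equal; ring|].
apply Rdiv_lt_0_compat; lra.
Qed.

(** The majorant for the passage to the limit. The conditions on [k] involve [q] but not [b], so a
    single rank serves all exponents; and [q] is free, so the decay in [b] beats any geometric
    growth. *)
Lemma Rpower_mul_risebin_le (b q : R) (k : nat) :
  -1 < b -> 0 < q -> 2 <= INR k -> 2 * (exp 2 * q) <= INR k ->
  Rabs (Rpower (INR k) (1 - b) * risebin b k)
  <= 2 * exp (2 * (exp 2 * q)) * Rpower (/ q) (b + 1).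
Proof.
intros Hb Hq Hk2 Hk.
(* Beyond [q], the factor [exp 2] yields an extra [exp(-2 (b + 1))], which absorbs the polynomial
   factor [|b| (b + 1)]. *)
set (r := exp 2 * q) in *.
assert (Hr : 0 < r) by (apply Rmult_lt_0_compat; [apply exp_pos | easy]).
assert (H := INR_mul_risebin_le (b + 1) r k ltac:(lra) Hr Hk).
rewrite Rabs_mult, (Rabs_pos_eq (Rpower _ _)) by apply Rpower_nonneg.
assert (Hs : Rabs (risebin b k) * (b + INR k) = Rabs b * risebin (b + 1) k).
  rewrite <- (Rabs_pos_eq (b + INR k)) by lra.
  rewrite <- (Rabs_pos_eq (risebin (b + 1) k)) by (apply risebin_nonneg; lra).
  rewrite <- !Rabs_mult; f_equal; apply risebin_shift.
(* The factor 2 comes from [k <= 2 (b + k)], true for [b > -1] and [k >= 2]. *)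
assert (H2 : Rabs (risebin b k) * INR k <= 2 * (Rabs b * risebin (b + 1) k)).
  rewrite <- Hs; assert (Ha := Rabs_pos (risebin b k)); nra.
set (P := Rpower (INR k) (b + 1)) in *.
assert (HP : 0 < P) by apply exp_pos.
assert (Hsplit : Rpower (INR k) (1 - b) = INR k * INR k / P).
  replace (1 - b) with (1 + (1 + - (b + 1))) by ring.
  rewrite !(Rpower_plus 1), Rpower_Ropp, Rpower_1 by lra; fold P; field; lra.
assert (Hkr : Rpower (INR k / r) (b + 1)
              = P * (exp (- (2 * (b + 1))) * Rpower (/ q) (b + 1))).
  unfold P, Rpower; rewrite <- !exp_plus; f_equal.
  unfold Rdiv; rewrite ln_mult, !ln_Rinv; try lra; [|now apply Rinv_0_lt_compat].
  unfold r; rewrite ln_mult, ln_exp by (try apply exp_pos; easy); ring.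
rewrite Hkr in H; rewrite Hsplit.
set (E := exp (2 * r)) in *; set (Q := Rpower (/ q) (b + 1)) in *.
assert (HE : 0 < E) by apply exp_pos.
assert (HQ : 0 < Q) by apply exp_pos.
assert (Hba : Rabs b <= exp (b + 1)).
  generalize (exp_ineq1_le (b + 1)); intros.
  unfold Rabs; destruct (Rcase_abs b); [|lra].
  assert (1 <= exp (b + 1)); [rewrite <- exp_0 at 1; apply exp_le_compat|]; lra.
assert (Hbb : b + 1 <= exp (b + 1))
  by (generalize (exp_ineq1_le (b + 1)); lra).
assert (Hprod : Rabs b * (b + 1) * exp (- (2 * (b + 1))) <= 1).
  apply Rle_trans with (exp (b + 1) * exp (b + 1) * exp (- (2 * (b + 1))));
    [|right; rewrite <- !exp_plus; apply eq_trans with (2 := exp_0); f_equal; ring].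
  apply Rmult_le_compat_r; [left; apply exp_pos|].
  apply Rmult_le_compat; [apply Rabs_pos | lra | easy | easy].
apply (Rmult_le_reg_r P); [easy|].
replace (INR k * INR k / P * Rabs (risebin b k) * P)
  with (INR k * (Rabs (risebin b k) * INR k)) by (field; lra).
apply Rle_trans with (INR k * (2 * (Rabs b * risebin (b + 1) k)));
  [apply Rmult_le_compat_l; lra|].
replace (INR k * (2 * (Rabs b * risebin (b + 1) k)))
  with (2 * Rabs b * (INR k * risebin (b + 1) k)) by ring.
apply Rle_trans with
  (2 * Rabs b * ((b + 1) * (E * (P * (exp (- (2 * (b + 1))) * Q))))).
  apply Rmult_le_compat_l; [generalize (Rabs_pos b); lra | exact H].
replace (2 * Rabs b * ((b + 1) * (E * (P * (exp (- (2 * (b + 1))) * Q)))))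
  with (2 * E * Q * P * (Rabs b * (b + 1) * exp (- (2 * (b + 1))))) by ring.
rewrite <- (Rmult_1_r (2 * E * Q * P)) at 2.
apply Rmult_le_compat_l; [|exact Hprod].
repeat apply Rmult_le_pos; lra.
Qed.

(** * Expansion of the generating functions in powers of [xi] *)

Lemma Rpower_mult_INR (x y : R) (m : nat) :
  Rpower x (y * INR m) = Rpower x y ^ m.
Proof.
rewrite <- Rpower_mult, Rpower_pow by apply exp_pos; easy.
Qed.

Lemma ex_series_risebin (b u : R) :
  Rabs u < 1 -> ex_series (fun m => risebin b m * u ^ m).
Proof. intros Hu; eexists; now apply is_series_risebin. Qed.

(* Coefficients of [(1 - u)^(-b) * (1 + xi * (1 - u)^(-alpha))^(-nu)]. *)
Definition expansion_coef (alpha nu b xi : R) (k : nat) : R :=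
  Series (fun m => risebin nu m * (- xi) ^ m * risebin (alpha * INR m + b) k).

Section Expansion.

Variables alpha nu b xi : R.
Hypothesis alpha_bounds : 0 < alpha <= 1.
Hypothesis nu_pos : 0 < nu.
Hypothesis xi_bounds : 0 < xi < 1 / 2.

(** The modulus of the [m]-th term with [(1 - u)^(-(alpha m + b))] evaluated at [u = 1/2], the
    radius of the estimates below. [Rabs b] is used because [b = alpha nu - alpha] can be
    negative. *)
Let expansion_majorant (m : nat) : R :=
  risebin nu m * xi ^ m * Rpower (1 - 1 / 2) (- (alpha * INR m + Rabs b)).

Lemma Rpower_half_opp_le_2 : Rpower (1 - 1 / 2) (- alpha) <= 2.
Proof.
unfold Rpower; replace (1 - 1 / 2) with (/ 2) by field.
rewrite ln_Rinv by lra.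
rewrite <- (exp_ln 2) at 2 by lra; apply exp_le_compat.
assert (0 < ln 2) by (rewrite <- ln_1; apply ln_increasing; lra); nra.
Qed.

(** Up to a constant this is the binomial series of parameter [nu] at [xi 2^alpha], which is below 1
    because [alpha <= 1] and [xi < 1/2]. *)
Lemma ex_series_expansion_majorant : ex_series expansion_majorant.
Proof.
set (w := Rpower (1 - 1 / 2) (- alpha)).
apply ex_series_ext with (fun m =>
  scal (Rpower (1 - 1 / 2) (- Rabs b)) (risebin nu m * (xi * w) ^ m)).
  intros m; unfold expansion_majorant, scal; simpl; unfold mult; simpl.
  replace (- (alpha * INR m + Rabs b)) with (- Rabs b + - alpha * INR m) by ring.
  rewrite Rpower_plus, Rpower_mult_INR, Rpow_mult_distr; fold w; ring.
apply (ex_series_scal (V := R_NormedModule)), ex_series_risebin.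
assert (Hw : 0 < w) by apply exp_pos.
assert (Hw2 : w <= 2) by apply Rpower_half_opp_le_2.
rewrite Rabs_pos_eq; nra.
Qed.

Lemma exponent_abs_le (m : nat) :
  Rabs (alpha * INR m + b) <= alpha * INR m + Rabs b.
Proof.
assert (Hp : 0 <= alpha * INR m) by (apply Rmult_le_pos; [lra | apply pos_INR]).
eapply Rle_trans; [apply Rabs_triang|]; rewrite (Rabs_pos_eq _ Hp); lra.
Qed.

Lemma exponent_bound_nonneg (m : nat) : 0 <= alpha * INR m + Rabs b.
Proof. eapply Rle_trans; [apply Rabs_pos | apply exponent_abs_le]. Qed.

Lemma expansion_term_abs (m : nat) :
  Rabs (risebin nu m * (- xi) ^ m) = risebin nu m * xi ^ m.
Proof.
rewrite Rabs_mult, <- RPow_abs, Rabs_Ropp, (Rabs_pos_eq xi) by lra.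
rewrite Rabs_pos_eq; [easy | left; now apply risebin_pos].
Qed.

Lemma expansion_term_nonneg (m : nat) : 0 <= risebin nu m * xi ^ m.
Proof. rewrite <- expansion_term_abs; apply Rabs_pos. Qed.

(** The Cauchy estimate at radius [1/2] bounds the [k]-th coefficient by [2^k] times the
    majorant. *)
Lemma ex_series_expansion_coef (k : nat) :
  ex_series (fun m => risebin nu m * (- xi) ^ m * risebin (alpha * INR m + b) k).
Proof.
apply (ex_series_le (V := R_CompleteNormedModule) _ (fun m => scal (2 ^ k) (expansion_majorant m))).
  intros m; unfold norm, scal; simpl; unfold abs, mult; simpl; unfold expansion_majorant.
  rewrite Rabs_mult, expansion_term_abs.
  set (A := risebin nu m * xi ^ m); rewrite (Rmult_comm (2 ^ k)), Rmult_assoc.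
  apply Rmult_le_compat_l; [apply expansion_term_nonneg|].
  eapply Rle_trans; [apply risebin_abs_le, exponent_abs_le|].
  apply (Rmult_le_reg_r ((1 / 2) ^ k)); [apply pow_lt; lra|].
  rewrite Rmult_assoc, <- Rpow_mult_distr.
  replace (2 * (1 / 2)) with 1 by field; rewrite pow1, Rmult_1_r.
  apply risebin_mul_pow_le; [apply exponent_bound_nonneg | lra].
apply (ex_series_scal (V := R_NormedModule)), ex_series_expansion_majorant.
Qed.

(** Interchanges the finite sum over [k] with the series over [m]. Summability is carried through
    the induction because adding two series requires it. *)
Lemma sum_n_expansion_coef (u : R) (n : nat) :
  ex_series (fun m => risebin nu m * (- xi) ^ m
    * sum_n (fun k => risebin (alpha * INR m + b) k * u ^ k) n) /\
  sum_n (fun k => scal (pow_n u k) (expansion_coef alpha nu b xi k)) n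
  = Series (fun m => risebin nu m * (- xi) ^ m
      * sum_n (fun k => risebin (alpha * INR m + b) k * u ^ k) n).
Proof.
assert (Hterm : forall k,
  ex_series (fun m => u ^ k *
    (risebin nu m * (- xi) ^ m * risebin (alpha * INR m + b) k))).
  intros k; apply (ex_series_scal (V := R_NormedModule) (u ^ k)),
    ex_series_expansion_coef.
induction n as [|n [IHex IH]].
  assert (He : forall m, u ^ 0 * (risebin nu m * (- xi) ^ m * risebin (alpha * INR m + b) 0)
    = risebin nu m * (- xi) ^ m
      * sum_n (fun k => risebin (alpha * INR m + b) k * u ^ k) 0)
    by (intros m; rewrite sum_O; ring).
  split; [exact (ex_series_ext _ _ He (Hterm 0%nat))|].
  rewrite sum_O, pow_n_pow, <- (Series_ext _ _ He); symmetry; apply Series_scal_l.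
assert (He : forall m, risebin nu m * (- xi) ^ m
      * sum_n (fun k => risebin (alpha * INR m + b) k * u ^ k) n
    + u ^ S n * (risebin nu m * (- xi) ^ m * risebin (alpha * INR m + b) (S n))
    = risebin nu m * (- xi) ^ m
      * sum_n (fun k => risebin (alpha * INR m + b) k * u ^ k) (S n))
  by (intros m; rewrite sum_Sn; unfold plus; simpl; ring).
split.
  apply (ex_series_ext _ _ He).
  exact (ex_series_plus (V := R_NormedModule) _ _ IHex (Hterm (S n))).
rewrite <- (Series_ext _ _ He), Series_plus by easy.
rewrite <- IH, sum_Sn, pow_n_pow, Series_scal_l; reflexivity.
Qed.

(** Tannery's theorem lets [n] tend to infinity under the sum over [m], where each inner sum is a
    binomial series in [u]. The outer sum is then the binomial series of parameter [nu] at
    [-xi (1 - u)^(-alpha)]. *)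
Lemma is_pseries_expansion_coef (u : R) :
  Rabs u <= 1 / 2 ->
  is_pseries (expansion_coef alpha nu b xi) u
    (Rpower (1 - u) (- b) * Rpower (1 + xi * Rpower (1 - u) (- alpha)) (- nu)).
Proof.
intros Hu.
assert (Hu1 : 1 / 2 <= 1 - u) by (apply Rabs_le_between in Hu; lra).
set (w := Rpower (1 - u) (- alpha)).
assert (Hw : 0 < w <= 2).
  split; [apply exp_pos|].
  eapply Rle_trans; [|apply Rpower_half_opp_le_2].
  unfold w; rewrite !Rpower_Ropp; apply Rinv_le_contravar; [apply exp_pos|].
  apply Rle_Rpower_l; lra.
assert (Hlim : is_lim_seq (fun n => Series (fun m => risebin nu m * (- xi) ^ m
      * sum_n (fun k => risebin (alpha * INR m + b) k * u ^ k) n))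
  (Series (fun m => risebin nu m * (- xi) ^ m
      * Rpower (1 - u) (- (alpha * INR m + b))))).
  apply is_lim_seq_Series_dominated with expansion_majorant.
  - apply ex_series_expansion_majorant.
  - exists 0%nat; intros n _ m.
    rewrite Rabs_mult, expansion_term_abs; apply Rmult_le_compat_l; [apply expansion_term_nonneg|].
    eapply Rle_trans; [|apply (sum_n_risebin_le _ (1 / 2) n);
                         [apply exponent_bound_nonneg | lra]].
    rewrite !sum_n_Reals; eapply Rle_trans; [apply Rsum_abs|].
    apply sum_Rle; intros j _; rewrite Rabs_mult, <- RPow_abs.
    apply Rmult_le_compat; [apply Rabs_pos | apply pow_le, Rabs_pos | |].
      apply risebin_abs_le, exponent_abs_le.
    apply pow_incr; split; [apply Rabs_pos | exact Hu].
  - intros m.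
    apply (is_lim_seq_scal_l _ (risebin nu m * (- xi) ^ m) (Rpower (1 - u) _)).
    apply is_series_risebin; lra.
replace (Rpower (1 - u) (- b) * Rpower (1 + xi * w) (- nu))
  with (Series (fun m => risebin nu m * (- xi) ^ m
      * Rpower (1 - u) (- (alpha * INR m + b)))).
  exact (is_lim_seq_ext _ _ (Finite _)
    (fun n => eq_sym (proj2 (sum_n_expansion_coef u n))) Hlim).
rewrite (Series_ext _ (fun m =>
  Rpower (1 - u) (- b) * (risebin nu m * (- (xi * w)) ^ m))).
  rewrite Series_scal_l; f_equal; apply is_series_unique.
  replace (1 + xi * w) with (1 - - (xi * w)) by ring.
  apply is_series_risebin; rewrite Rabs_Ropp, Rabs_pos_eq; nra.
intros m.
replace (- (alpha * INR m + b)) with (- b + - alpha * INR m) by ring.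
replace (- (xi * w)) with (- xi * w) by ring.
rewrite Rpower_plus, Rpower_mult_INR, Rpow_mult_distr; fold w; ring.
Qed.

End Expansion.

(** * Limit of the rescaled series *)

(** Tannery's theorem in [k]. The limit uses [b / Gamma (b + 1)] rather than [1 / Gamma b] because
    the exponent [alpha nu - alpha] needed for [psi] may be nonpositive. *)
Lemma is_lim_seq_Series_risebin (alpha nu b lam : R) :
  0 < alpha -> 0 < nu -> -1 < b -> 0 < lam ->
  is_lim_seq
    (fun k => Series (fun m => risebin nu m * (- lam) ^ m
       * (Rpower (INR k) (1 - (alpha * INR m + b)) * risebin (alpha * INR m + b) k)))
    (Series (fun m => risebin nu m * (- lam) ^ m
       * ((alpha * INR m + b) / Gamma (alpha * INR m + b + 1)))).
Proof.
intros Ha Hnu Hb Hlam.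
assert (Hm : forall m, -1 < alpha * INR m + b).
  intros m; assert (0 <= alpha * INR m) by (apply Rmult_le_pos; [lra | apply pos_INR]).
  lra.
(* chosen so that [lam * q^(-alpha) = 1/2] *)
set (q := Rpower (2 * lam) (/ alpha)).
assert (Hq : 0 < q) by apply exp_pos.
set (r := exp 2 * q).
apply is_lim_seq_Series_dominated with (fun m => risebin nu m * lam ^ m
  * (2 * exp (2 * r) * Rpower (/ q) (alpha * INR m + b + 1))).
- apply ex_series_ext with (fun m =>
    scal (2 * exp (2 * r) * Rpower (/ q) (b + 1)) (risebin nu m * (1 / 2) ^ m)).
    intros m; unfold scal; simpl; unfold mult; simpl.
    replace (alpha * INR m + b + 1) with (alpha * INR m + (b + 1)) by ring.
    rewrite (Rpower_plus (alpha * INR m)), Rpower_mult_INR.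
    replace (1 / 2) with (lam * Rpower (/ q) alpha).
      rewrite Rpow_mult_distr; ring.
    replace (Rpower (/ q) alpha) with (/ (2 * lam)); [field; lra|].
    unfold q; rewrite <- Rpower_Ropp, Rpower_mult.
    replace (- / alpha * alpha) with (- (1)) by (field; lra).
    rewrite Rpower_Ropp, Rpower_1; lra.
  apply (ex_series_scal (V := R_NormedModule)), ex_series_risebin.
  rewrite Rabs_pos_eq; lra.
- assert (Hev : eventually (fun k => 2 <= INR k /\ 2 * r <= INR k)).
    destruct (nfloor_ex (2 + 2 * r)) as [N HN].
      assert (0 < r) by (apply Rmult_lt_0_compat; [apply exp_pos | easy]); lra.
    exists (S N); intros k Hk; apply le_INR in Hk; rewrite S_INR in Hk.
    assert (0 < r) by (apply Rmult_lt_0_compat; [apply exp_pos | easy]); lra.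
  apply filter_imp with (2 := Hev); intros k [Hk2 Hk] m.
  rewrite Rabs_mult, Rabs_mult, <- RPow_abs, Rabs_Ropp, (Rabs_pos_eq lam) by lra.
  rewrite (Rabs_pos_eq (risebin nu m)) by (left; now apply risebin_pos).
  apply Rmult_le_compat_l.
    apply Rmult_le_pos; [left; now apply risebin_pos | apply pow_le; lra].
  now apply Rpower_mul_risebin_le.
- intros m.
  apply (is_lim_seq_scal_l _ (risebin nu m * (- lam) ^ m) (_ / _)).
  now apply is_lim_seq_risebin_recip_Gamma.
Qed.

(** * Identification of the coefficients of [phi_bar] and [psi_bar] *)

(** Convergence at the point [eps / 2] forces the terms there to tend to 0, which is impossible
    outside the disk of convergence. *)
Lemma CV_radius_pos (a : nat -> R) (f : R -> R) :
  power_series_at_0 f a -> Rbar_lt 0 (CV_radius a).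
Proof.
intros [eps H].
assert (Heps := cond_pos eps).
assert (Hx : is_pseries a (eps / 2) (f (eps / 2))).
  apply H; unfold ball; simpl; unfold AbsRing_ball, abs, minus, plus, opp; simpl.
  rewrite Rabs_pos_eq; lra.
apply Rbar_lt_le_trans with (Finite (Rabs (eps / 2))).
  simpl; rewrite Rabs_pos_eq; lra.
apply Rbar_not_lt_le; intros Hlt; apply (CV_disk_outside a (eps / 2) Hlt).
apply is_lim_seq_ext with (fun n => scal (pow_n (eps / 2) n) (a n)).
  intros n; rewrite pow_n_pow; apply Rmult_comm.
apply (ex_series_lim_0 (fun n => scal (pow_n (eps / 2) n) (a n))).
now exists (f (eps / 2)).
Qed.

Lemma power_series_at_0_unique (f g : R -> R) (a b : nat -> R) :
  locally 0 (fun u : R => f u = g u) ->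
  power_series_at_0 f a -> power_series_at_0 g b -> forall k, a k = b k.
Proof.
intros Hfg Ha Hb k; apply PSeries_ext_recip.
- exact (CV_radius_pos a f Ha).
- exact (CV_radius_pos b g Hb).
- generalize (filter_and _ _ Hfg (filter_and _ _ Ha Hb)); apply filter_imp.
  intros u [E [H1 H2]].
  now rewrite (is_pseries_unique _ _ _ H1), (is_pseries_unique _ _ _ H2).
Qed.

Lemma locally_0_half : locally 0 (fun u : R => Rabs u <= 1 / 2).
Proof.
exists (mkposreal (1 / 2) ltac:(lra)); intros u Hu; unfold ball in Hu; simpl in Hu.
unfold AbsRing_ball, abs, minus, plus, opp in Hu; simpl in Hu.
rewrite Ropp_0, Rplus_0_r in Hu; lra.
Qed.

(** With [w = (1 - u)^alpha], this is [xi + w = w (1 + xi / w)] raised to the power [-nu]. *)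
Lemma phi_bar_factor (alpha nu xi u : R) :
  0 < xi -> u < 1 ->
  phi_bar alpha nu xi u = Rpower xi nu * (Rpower (1 - u) (- (alpha * nu))
    * Rpower (1 + xi * Rpower (1 - u) (- alpha)) (- nu)).
Proof.
intros Hxi Hu; unfold phi_bar, Rdiv; f_equal.
rewrite <- Rpower_Ropp.
replace (- (alpha * nu)) with (alpha * - nu) by ring.
rewrite <- Rpower_mult, Rpower_Ropp with (y := alpha).
set (w := Rpower (1 - u) alpha); assert (Hw : 0 < w) by apply exp_pos.
assert (Hd : 0 < xi * / w) by now apply Rdiv_lt_0_compat.
rewrite Rpower_mult_distr by lra; f_equal; field; lra.
Qed.

Lemma phi_bar_coef_eq (alpha nu xi : R) (a : nat -> R) (k : nat) :
  0 < alpha <= 1 -> 0 < nu -> 0 < xi < 1 / 2 ->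
  power_series_at_0 (phi_bar alpha nu xi) a ->
  a k = Rpower xi nu * expansion_coef alpha nu (alpha * nu) xi k.
Proof.
intros Ha Hnu Hxi H; revert k.
refine (power_series_at_0_unique _ _ _ _ _ H _).
  apply filter_imp with (2 := locally_0_half); intros u Hu.
  apply Rabs_le_between in Hu; apply phi_bar_factor; lra.
apply filter_imp with (2 := locally_0_half); intros u Hu.
exact (is_pseries_scal (V := R_NormedModule) (Rpower xi nu) _ u _ (Rmult_comm _ _)
  (is_pseries_expansion_coef alpha nu (alpha * nu) xi Ha Hnu Hxi u Hu)).
Qed.

Lemma psi_bar_coef_eq (alpha nu xi : R) (a : nat -> R) (k : nat) :
  0 < alpha <= 1 -> 0 < nu -> 0 < xi < 1 / 2 ->
  power_series_at_0 (psi_bar alpha nu xi) a ->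
  a k = Rpower xi nu * (expansion_coef alpha nu (alpha * nu) xi k
                        - expansion_coef alpha nu (alpha * nu - alpha) xi k).
Proof.
intros Ha Hnu Hxi H; revert k.
refine (power_series_at_0_unique _ _ _ _ _ H _).
  apply filter_imp with (2 := locally_0_half); intros u Hu.
  apply Rabs_le_between in Hu.
  transitivity ((1 - Rpower (1 - u) alpha) * phi_bar alpha nu xi u); [reflexivity|].
  rewrite phi_bar_factor by lra.
  transitivity (Rpower xi nu * (Rpower (1 - u) (- (alpha * nu))
    * Rpower (1 + xi * Rpower (1 - u) (- alpha)) (- nu)
    - Rpower (1 - u) (- (alpha * nu - alpha))
      * Rpower (1 + xi * Rpower (1 - u) (- alpha)) (- nu))); [|reflexivity].
  (* Multiplication by [(1 - u)^alpha] only lowers the exponent [b] from [alpha nu] to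
     [alpha nu - alpha]. *)
  replace (- (alpha * nu - alpha)) with (alpha + - (alpha * nu)) by ring.
  rewrite (Rpower_plus alpha); ring.
apply filter_imp with (2 := locally_0_half); intros u Hu.
exact (is_pseries_scal (V := R_NormedModule) (Rpower xi nu) _ u _ (Rmult_comm _ _)
  (is_pseries_minus (V := R_NormedModule) _ _ u _ _
    (is_pseries_expansion_coef alpha nu (alpha * nu) xi Ha Hnu Hxi u Hu)
    (is_pseries_expansion_coef alpha nu (alpha * nu - alpha) xi Ha Hnu Hxi u Hu))).
Qed.

(** * Rescaling and conclusion *)

Lemma is_lim_seq_Rpower_INR_opp (alpha : R) :
  0 < alpha -> is_lim_seq (fun k => Rpower (INR k) (- alpha)) 0.
Proof.
intros Ha.
apply is_lim_seq_ext with (fun k => exp (- (alpha * ln (INR k)))).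
  intros k; unfold Rpower; f_equal; ring.
apply (filterlim_comp _ _ _ (fun k => ln (INR k)) (fun s => exp (- (alpha * s)))
         _ (Rbar_locally p_infty)).
  apply (filterlim_comp _ _ _ INR ln _ (Rbar_locally p_infty)).
    apply is_lim_seq_INR.
  apply is_lim_ln_p.
now apply filterlim_exp_neg_scal.
Qed.

(** Counting powers of [k]: the left side carries [k^(1 - alpha nu - alpha m)], which is
    [k^(1 - (alpha m + b))] times [k^(b - alpha nu)]. The last factor is 1 for [b = alpha nu] and
    [k^(-alpha)] for [b = alpha nu - alpha]. *)
Lemma expansion_coef_rescaled (alpha nu b lam : R) (k : nat) :
  0 < lam -> 1 <= INR k ->
  INR k * (Rpower (lam * Rpower (INR k) (- alpha)) nu
    * expansion_coef alpha nu b (lam * Rpower (INR k) (- alpha)) k)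
  = Rpower lam nu * Rpower (INR k) (b - alpha * nu)
    * Series (fun m => risebin nu m * (- lam) ^ m
        * (Rpower (INR k) (1 - (alpha * INR m + b)) * risebin (alpha * INR m + b) k)).
Proof.
intros Hlam Hk; unfold expansion_coef.
rewrite <- Rpower_mult_distr, Rpower_mult by (easy || apply exp_pos).
rewrite <- !Rmult_assoc, <- !Series_scal_l; apply Series_ext; intros m.
replace (- (lam * Rpower (INR k) (- alpha)))
  with (- lam * Rpower (INR k) (- alpha)) by ring.
rewrite Rpow_mult_distr, <- Rpower_mult_INR.
rewrite <- (Rpower_1 (INR k)) at 1 by lra.
replace (Rpower (INR k) (b - alpha * nu)) with
  (Rpower (INR k) (- alpha * nu) * Rpower (INR k) b)
  by (rewrite <- Rpower_plus; f_equal; ring).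
replace (Rpower (INR k) (1 - (alpha * INR m + b))) with
  (Rpower (INR k) 1 * Rpower (INR k) (- alpha * INR m) * Rpower (INR k) (- b))
  by (rewrite <- !Rpower_plus; f_equal; ring).
rewrite (Rpower_Ropp _ b); field; apply Rgt_not_eq, exp_pos.
Qed.

Theorem mainTheorem2 (alpha nu xi0 : R)
    (alpha_bounds : 0 < alpha <= 1) (nu_pos : 0 < nu) (xi0_pos : 0 < xi0)
    (phi psi : nat -> R -> R)
    (phi_coef : forall xi : R, 0 < xi ->
       power_series_at_0 (phi_bar alpha nu xi) (fun k => phi k xi))
    (psi_coef : forall xi : R, 0 < xi ->
       power_series_at_0 (psi_bar alpha nu xi) (fun k => psi k xi))
    (t : R) (t_pos : 0 < t) :
  let limit := Rpower xi0 nu * Rpower t (alpha * nu - 1)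
               * prabhakar alpha (alpha * nu) nu (- xi0 * Rpower t alpha) in
  is_lim_seq
    (fun k : nat => let h := t / INR k in
                    1 / h * psi k (xi0 * Rpower h alpha))
    (Finite limit)
  /\
  is_lim_seq
    (fun k : nat => let h := t / INR k in
                    1 / h * phi k (xi0 * Rpower h alpha))
    (Finite limit).
Proof.
intros limit.
set (lam := xi0 * Rpower t alpha).
assert (Hlam : 0 < lam) by (apply Rmult_lt_0_compat; [easy | apply exp_pos]).
(* From here on [S] names the rescaled sum, not the successor. *)
set (S := fun b k => Series (fun m => risebin nu m * (- lam) ^ m
  * (Rpower (INR k) (1 - (alpha * INR m + b)) * risebin (alpha * INR m + b) k))).
assert (HS : forall b, -1 < b -> is_lim_seq (S b)
  (Series (fun m => risebin nu m * (- lam) ^ m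
     * ((alpha * INR m + b) / Gamma (alpha * INR m + b + 1)))))
  by (intros b Hb; now apply is_lim_seq_Series_risebin).
assert (Han : 0 < alpha * nu) by (apply Rmult_lt_0_compat; lra).
assert (Hpow := is_lim_seq_Rpower_INR_opp alpha (proj1 alpha_bounds)).
assert (Hphi : is_lim_seq (fun k => Rpower lam nu / t * S (alpha * nu) k) limit).
  replace (Finite limit) with (Rbar_mult (Rpower lam nu / t)
    (Series (fun m => risebin nu m * (- lam) ^ m * ((alpha * INR m + alpha * nu)
       / Gamma (alpha * INR m + alpha * nu + 1))))).
    apply is_lim_seq_scal_l, HS; lra.
  simpl; f_equal; unfold limit, prabhakar.
  replace (Rpower lam nu / t) with (Rpower xi0 nu * Rpower t (alpha * nu - 1)).
    f_equal; apply Series_ext; intros m.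
    assert (Hp : 0 < alpha * INR m + alpha * nu).
      assert (0 <= alpha * INR m) by (apply Rmult_le_pos; [lra | apply pos_INR]); lra.
    (* For positive exponents the continued value [p / Gamma (p + 1)] is [1 / Gamma p], as in
       [prabhakar]. *)
    rewrite Gamma_plus_1 by exact Hp.
    unfold risebin, lam, Rdiv; rewrite Rinv_mult.
    replace (- (xi0 * Rpower t alpha)) with (- xi0 * Rpower t alpha) by ring.
    set (p := alpha * INR m + alpha * nu) in *.
    rewrite <- (Rmult_assoc p), Rinv_r by lra; ring.
  unfold lam; rewrite <- Rpower_mult_distr, Rpower_mult by (easy || apply exp_pos).
  unfold Rminus, Rdiv; rewrite Rpower_plus, Rpower_Ropp, Rpower_1 by easy; ring.
(* The expansions require [xi < 1/2]; here [xi = lam k^(-alpha)] tends to 0. *)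
assert (Hev : eventually (fun k => 1 <= INR k
                            /\ 0 < lam * Rpower (INR k) (- alpha) < 1 / 2)).
  assert (Hl : is_lim_seq (fun k => lam * Rpower (INR k) (- alpha)) 0).
    replace (Finite 0) with (Rbar_mult lam 0) by (simpl; f_equal; ring).
    now apply is_lim_seq_scal_l.
  apply is_lim_seq_spec in Hl.
  specialize (Hl (mkposreal (1 / 2) ltac:(lra))).
  generalize (filter_and _ _ eventually_INR_pos Hl); apply filter_imp.
  intros k [Hk Hk2]; split; [easy|]; simpl in Hk2; rewrite Rminus_0_r in Hk2.
  assert (Hp : 0 < lam * Rpower (INR k) (- alpha))
    by (apply Rmult_lt_0_compat; [easy | apply exp_pos]).
  rewrite Rabs_pos_eq in Hk2; lra.
assert (Hxi : forall k, 1 <= INR k ->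
          xi0 * Rpower (t / INR k) alpha = lam * Rpower (INR k) (- alpha)).
  intros k Hk; unfold lam, Rdiv.
  rewrite <- Rpower_mult_distr by (easy || apply Rinv_0_lt_compat; lra).
  rewrite (Rpower_Ropp (INR k)); unfold Rpower at 2; rewrite ln_Rinv by lra.
  replace (alpha * - ln (INR k)) with (- (alpha * ln (INR k))) by ring.
  rewrite exp_Ropp; fold (Rpower (INR k) alpha); ring.
split.
- apply is_lim_seq_ext_loc with (fun k => Rpower lam nu / t * S (alpha * nu) k
    - Rpower lam nu / t * (Rpower (INR k) (- alpha) * S (alpha * nu - alpha) k)).
    generalize Hev; apply filter_imp; intros k [Hk Hk2]; cbv zeta.
    rewrite Hxi by easy.
    rewrite (psi_bar_coef_eq alpha nu _ (fun k => psi k _) k alpha_bounds nu_pos Hk2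
               (psi_coef _ (proj1 Hk2))).
    transitivity (/ t * (INR k * (Rpower (lam * Rpower (INR k) (- alpha)) nu
      * expansion_coef alpha nu (alpha * nu) (lam * Rpower (INR k) (- alpha)) k)
      - INR k * (Rpower (lam * Rpower (INR k) (- alpha)) nu
      * expansion_coef alpha nu (alpha * nu - alpha) (lam * Rpower (INR k) (- alpha)) k)));
      [|field; lra].
    rewrite !expansion_coef_rescaled by easy.
    replace (alpha * nu - alpha * nu) with 0 by ring.
    replace (alpha * nu - alpha - alpha * nu) with (- alpha) by ring.
    rewrite Rpower_O by lra; unfold S; field; lra.
  (* The subtracted part is [k^(-alpha)] times a convergent sequence, so its limit is 0 times a
     finite value. *)
  replace limit with (limit - Rpower lam nu / t * (0 *
    Series (fun m => risebin nu m * (- lam) ^ m * ((alpha * INR m + (alpha * nu - alpha))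
       / Gamma (alpha * INR m + (alpha * nu - alpha) + 1))))) by ring.
  apply is_lim_seq_minus'; [exact Hphi|].
  apply (is_lim_seq_scal_l _ (Rpower lam nu / t) (0 * _)).
  apply is_lim_seq_mult'; [exact Hpow | apply HS; lra].
- apply is_lim_seq_ext_loc with (2 := Hphi).
  generalize Hev; apply filter_imp; intros k [Hk Hk2]; cbv zeta.
  rewrite Hxi by easy.
  rewrite (phi_bar_coef_eq alpha nu _ (fun k => phi k _) k alpha_bounds nu_pos Hk2
             (phi_coef _ (proj1 Hk2))).
  transitivity (/ t * (INR k * (Rpower (lam * Rpower (INR k) (- alpha)) nu
    * expansion_coef alpha nu (alpha * nu) (lam * Rpower (INR k) (- alpha)) k)));
    [|field; lra].
  rewrite expansion_coef_rescaled by easy.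
  replace (alpha * nu - alpha * nu) with 0 by ring.
  rewrite Rpower_O by lra; unfold S; field; lra.
Qed.
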